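(* Let $n\geq 3$ and let $C_n$ be the cycle on $n$ vertices. In the Toucher–Isolator game played on $C_n$, when both players play optimally, the number of untouched vertices at the end of the game is exactly $u(C_n)=\left\lfloor \frac{n+1}{5}\right\rfloor$.
   Context: The Toucher–Isolator game on a finite graph $G$: two players, Toucher and Isolator, alternately claim previously unclaimed edges of $G$, with Toucher moving first, until all edges are claimed. A vertex is touched if it is incident to at least one edge claimed by Toucher, and untouched otherwise. Toucher aims to maximise the number of touched vertices and Isolator aims to minimise it (equivalently, Isolator maximises the number of untouched vertices). $u(G)$ denotes the number of untouched vertices at the end of the game when both players play optimally. *)

(* Defs.v *)
From mathcomp Require Import all_boot.

Set Implicit Arguments.
Unset Strict Implicit.
Unset Printing Implicit Defensive.

Record sgraph := SGraph {
  vertex :> finType;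
  adj : rel vertex;
  adj_sym : symmetric adj;
  adj_irrefl : irreflexive adj
}.

(* An edge is the two-element set of its endpoints. *)
Definition edges (G : sgraph) : {set {set G}} :=
  [set [set p.1; p.2] | p : G * G & adj p.1 p.2].

Inductive player := Toucher | Isolator.

Section Game.
Variable G : sgraph.
Implicit Types T I : {set {set G}}.

Definition touched T (v : G) : bool := [exists e in T, v \in e].

Definition untouched T : {set G} := [set v | ~~ touched T v].

Definition unclaimed T I : {set {set G}} := edges G :\: (T :|: I).

(* Minimax number of untouched vertices at the end of the game, from the
   position in which Toucher holds the edges T, Isolator holds the edges I, and
   player p is to claim the next edge.  The recursion argument k is the number
   of edges still to be claimed; for k = #|unclaimed T I| the min and the max
   below always range over a nonempty set of moves.  The default #|G| of the min
   bounds every outcome from above, so it does not affect that min. *)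
Fixpoint game_value (k : nat) (p : player) T I : nat :=
  if k is k'.+1 then
    match p with
    | Toucher =>
        \big[minn/#|G|]_(e in unclaimed T I)
          game_value k' Isolator (e |: T) I
    | Isolator =>
        \max_(e in unclaimed T I)
          game_value k' Toucher T (e |: I)
    end
  else #|untouched T|.

End Game.

Definition u (G : sgraph) : nat :=
  @game_value G #|edges G| Toucher set0 set0.

(* ordS is the cyclic successor modulo n.  The conjunct i != j only matters for
   n = 1, where it excludes a loop. *)
Definition cycle_adj (n : nat) : rel 'I_n :=
  fun i j => (i != j) && ((j == ordS i) || (i == ordS j)).

Lemma cycle_adj_sym n : symmetric (@cycle_adj n).
Proof. by move=> i j; rewrite /cycle_adj eq_sym orbC. Qed.

Lemma cycle_adj_irrefl n : irreflexive (@cycle_adj n).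
Proof. by move=> i; rewrite /cycle_adj eqxx. Qed.

Definition cycle_graph (n : nat) : sgraph :=
  SGraph (@cycle_adj_sym n) (@cycle_adj_irrefl n).

(* Main.v *)
Require Import Defs.
From mathcomp Require Import all_boot.
From mathcomp Require Import zify.

(* After Toucher's first move, the unclaimed edges always form runs between
   claimed edges, and a move cuts one run into two.  The game is thus a sum of
   independent runs, and it is estimated as in the theory of hot games: each run
   gets a weight for the case where Isolator moves in it next (hi) and one for
   the case where Toucher does (lo), and both players follow the rule "answer a
   threat where it is made, otherwise make any move that gains half a vertex".
   Let v be the final number of untouched vertices and sum the weights over all
   runs.  Toucher keeps 2 v <= sum hi + 1 when Isolator is to move.  For the
   bound 2 v >= sum lo when Isolator is to move, lo is refined to pw (in quarters
   of a vertex), and Isolator keeps 4 v >= sum pw.  At the start there is a single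
   run of n - 1 edges with both ends Toucher's, for which the two bounds leave
   only the value (n + 1) / 5; rounding to an integer absorbs the slack. *)

Set Implicit Arguments.
Unset Strict Implicit.
Unset Printing Implicit Defensive.

(** * Weights of a single run and the effect of one move on them *)

(* hi c k / 2 and lo c k / 2 estimate what a run of k unclaimed edges is worth
   to Isolator when she, respectively Toucher, is about to move in it and every
   move costs its player 1/2; c counts the ends of the run closed off by
   Isolator.  The isolated cases are short runs off the period-5 pattern. *)
Definition hi (c k : nat) : nat :=
  match c, k with
  | 1, 0 => 0
  | 2, 1 => 3
  | 2, 2 => 2
  | _, _ => (2 * k + 6 * c) %/ 5
  end.

Definition lo (c k : nat) : nat :=
  match c, k with
  | 0, _ => (2 * k - 1) %/ 5
  | 1, _ => (2 * k + 3) %/ 5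
  | _, 0 => 2
  | _, 1 => 1
  | _, _ => (2 * k + 9) %/ 5
  end.

(* This is 2 * lo, plus 1 on the runs with one Isolator end where hi exceeds lo:
   two such runs together are worth one half-vertex more than lo tells,
   since Isolator gets one of them whenever Toucher attacks the other. *)
Definition pw (c k : nat) : nat :=
  match c, k with
  | 1, 0 => 0
  | 1, _ => (4 * k + 7) %/ 5
  | _, _ => 2 * lo c k
  end.

Arguments hi : simpl never.
Arguments lo : simpl never.
Arguments pw : simpl never.

Ltac seg_cases a b := case: a; case: b; rewrite ?addn0 ?add0n ?addn1.

Lemma lo_le_hi (a b : bool) k : lo (a + b) k <= hi (a + b) k.
Proof. by seg_cases a b; case: k => [|[|[|k]]]; rewrite /lo /hi //=; lia. Qed.

(** When Isolator cuts a run, Toucher can answer in one of the two pieces, which then counts [lo]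
    instead of [hi]; the [+ 1] is what the upper bound concedes when Isolator is to move. *)
Lemma hi_isolator (a b : bool) i j :
  hi (a + 1) i + lo (1 + b) j <= hi (a + b) (i + j.+1) + 1 \/
  lo (a + 1) i + hi (1 + b) j <= hi (a + b) (i + j.+1) + 1.
Proof.
by seg_cases a b; case: i => [|[|[|i]]]; case: j => [|[|[|j]]];
   rewrite ?addnS ?addSn ?addn0 ?add0n /lo /hi /=; lia.
Qed.

(** Toucher plays beside an Isolator end, or takes the third edge when both ends are his. The gained
    [+ 1] pays for the concession made to Isolator, who moves next. In the excluded nonempty runs
    [hi] and [lo] are both 0. *)
Lemma hi_toucher (a b : bool) k : 0 < k -> (0 < a + b) || (2 < k) ->
  exists i j, k = i + j.+1 /\ hi a i + hi b j + 1 <= lo (a + b) k.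
Proof.
move=> k0 kab.
suff [i ik h] : exists2 i, i < k & hi a i + hi b (k - i.+1) + 1 <= lo (a + b) k.
  by exists i, (k - i.+1); split=> //; lia.
move: k0 kab; seg_cases a b => //= k0 kab.
- exists 0 => //; case: k k0 kab => [|[|[|[|k]]]] //= _ _;
    rewrite ?subn1 /lo /hi /=; lia.
- exists 0 => //; case: k k0 kab => [|[|[|[|k]]]] //= _ _;
    rewrite ?subn1 /lo /hi /=; lia.
- exists k.-1; first lia. rewrite prednK // subnn.
  by case: k k0 kab => [|[|[|[|k]]]] //= _ _; rewrite /lo /hi /=; lia.
- by exists 2 => //; rewrite /lo /hi /=; lia.
Qed.

(** In the first case Isolator may play anywhere; in the others Toucher's cut is a threat, answered
    in one piece, which then counts [2 * hi - 1] instead of [pw]. The 3 is the slack of the lower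
    bound with Toucher to move. *)
Lemma pw_toucher (a b : bool) i j (P := pw (a + b) (i + j.+1)) :
  [\/ P <= pw a i + pw b j + 3,
      P + 1 <= 2 * hi a i + pw b j + 3 |
      P + 1 <= pw a i + 2 * hi b j + 3].
Proof.
suff : (P <= pw a i + pw b j + 3) || (P + 1 <= 2 * hi a i + pw b j + 3) || 
      (P + 1 <= pw a i + 2 * hi b j + 3).
  by case/orP => [/orP[]|] h; [constructor 1|constructor 2|constructor 3].
rewrite {}/P.
by seg_cases a b; case: i => [|[|[|i]]]; case: j => [|[|[|j]]];
   rewrite ?addnS ?addSn ?addn0 ?add0n /pw /lo /hi /=; lia.
Qed.

(** The 2 leaves a net loss of only 1 after the slack 3 with Toucher to move. Isolator plays beside
    an end of hers if there is one. *)
Lemma pw_isolator (a b : bool) k : 0 < k -> (0 < a + b) || (1 < k) ->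
  exists i j, k = i + j.+1 /\
              2 * hi (a + b) k + 2 <= pw (a + 1) i + pw (1 + b) j.
Proof.
move=> k0 kab.
suff [i ik h] : exists2 i, i < k &
    2 * hi (a + b) k + 2 <= pw (a + 1) i + pw (1 + b) (k - i.+1).
  by exists i, (k - i.+1); split=> //; lia.
move: k0 kab; seg_cases a b => //= k0 kab.
- exists 0 => //; case: k k0 kab => [|[|[|[|k]]]] //= _ _;
    rewrite ?subn1 /pw /lo /hi /=; lia.
- exists 0 => //; case: k k0 kab => [|[|[|[|k]]]] //= _ _;
    rewrite ?subn1 /pw /lo /hi /=; lia.
- exists k.-1; first lia. rewrite prednK // subnn.
  by case: k k0 kab => [|[|[|[|k]]]] //= _ _; rewrite /pw /lo /hi /=; lia.
(* Leaving one edge on the left suffices except when 5 divides [k], where rounding costs a quarter;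
   leaving two edges recovers it. *)
- have [k5|k5] := boolP (5 %| k).
    exists 2; first lia.
    have -> : k = (k - 5).+4.+1 by lia.
    by rewrite /pw /lo /hi /=; lia.
  exists 1; first lia.
  by case: k k0 kab k5 => [|[|[|[|k]]]] //= _ _ k5; rewrite /pw /lo /hi /=; lia.
Qed.

Lemma pw_le_hi (a b : bool) k : pw (a + b) k <= 2 * hi (a + b) k.
Proof.
by seg_cases a b; case: k => [|[|[|k]]]; rewrite /pw /lo /hi //=; lia.
Qed.

(** In a run of odd weight the gain from [pw] to [2 * hi] covers the loss of 1, so Isolator can move
    there for free. *)
Lemma odd_pw_lt_hi (a b : bool) k :
  odd (pw (a + b) k) -> pw (a + b) k < 2 * hi (a + b) k.
Proof.
by seg_cases a b; case: k => [|[|[|k]]]; rewrite /pw /lo /hi //=; lia.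
Qed.

Lemma pw_le_size (a b : bool) k : pw (a + b) k <= 4 * k.+1.
Proof.
by seg_cases a b; case: k => [|[|[|k]]]; rewrite /pw /lo /hi //=; lia.
Qed.

(** * Positions as sequences of gaps *)

(* A cycle in which some edge is claimed is encoded as the cyclic sequence of its
   gaps: (k, b) stands for k unclaimed edges followed by a claimed one, which
   belongs to Isolator iff b. *)
Definition gap_word (s : seq (nat * bool)) : seq (option bool) :=
  flatten [seq rcons (nseq g.1 None) (Some g.2) | g <- s].

Definition blanks (s : seq (nat * bool)) : nat := sumn (unzip1 s).

(* The boolean a is the owner of the claimed edge preceding s. *)
Fixpoint pot (W : nat -> nat -> nat) (a : bool) (s : seq (nat * bool)) : nat :=
  if s is (k, b) :: s' then W (a + b) k + pot W b s' else 0.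

Lemma gap_word_cat s1 s2 : gap_word (s1 ++ s2) = gap_word s1 ++ gap_word s2.
Proof. by rewrite /gap_word map_cat flatten_cat. Qed.

Lemma gap_word_cons g s :
  gap_word (g :: s) = nseq g.1 None ++ Some g.2 :: gap_word s.
Proof. by rewrite /gap_word /= cat_rcons. Qed.

Lemma size_gap_word s : size (gap_word s) = blanks s + size s.
Proof.
rewrite /blanks; elim: s => //= g s IHs.
by rewrite gap_word_cons size_cat size_nseq /= IHs; lia.
Qed.

Lemma blanks_cat s1 s2 : blanks (s1 ++ s2) = blanks s1 + blanks s2.
Proof. by rewrite /blanks /unzip1 map_cat sumn_cat. Qed.

Lemma pot_cat W a s1 s2 :
  pot W a (s1 ++ s2) = pot W a s1 + pot W (last a (unzip2 s1)) s2.
Proof. by elim: s1 a => //= -[k b] s1 IHs a; rewrite IHs addnA. Qed.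

(** The form [i + k.+1] marks the edge to be claimed: it leaves [i] edges before it and [k] after
    it. All moves are described this way. *)
Lemma gap_word_split s j :
  j < size (gap_word s) -> nth None (gap_word s) j = None ->
  exists s1 i k p s2,
    s = s1 ++ (i + k.+1, p) :: s2 /\ j = size (gap_word s1) + i.
Proof.
elim: s j => // -[k b] s IHs j.
rewrite gap_word_cons size_cat size_nseq /= nth_cat size_nseq => jlt.
case: ltnP => [jk _|kj].
  exists [::], j, (k - j.+1), b, s; split=> //=.
  by rewrite addnS -addSn subnKC.
case def_j: (j - k) => [|j'] //= wj'.
have [|s1 [i [k' [p [s2 [-> j'E]]]]]] := IHs j' _ wj'; first lia.
exists ((k, b) :: s1), i, k', p, s2; split=> //.
by rewrite gap_word_cons size_cat size_nseq /=; lia.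
Qed.

Lemma nth_gap_word s1 i k p s2 :
  nth None (gap_word (s1 ++ (i + k.+1, p) :: s2)) (size (gap_word s1) + i) = None.
Proof.
rewrite gap_word_cat nth_cat ltnNge leq_addr /= addKn gap_word_cons.
by rewrite nth_cat size_nseq nth_nseq addnS ltnS leq_addr.
Qed.

Lemma set_nth_gap_word s1 i k p s2 q :
  set_nth None (gap_word (s1 ++ (i + k.+1, p) :: s2)) (size (gap_word s1) + i)
    (Some q) = gap_word (s1 ++ (i, q) :: (k, p) :: s2).
Proof.
rewrite !gap_word_cat; elim: (gap_word s1) => [|x w /= -> //].
rewrite !gap_word_cons /=; elim: i => [|i /= ->] //.
Qed.

Lemma blanks_split s1 i k p s2 q :
  blanks (s1 ++ (i + k.+1, p) :: s2) =
  (blanks (s1 ++ (i, q) :: (k, p) :: s2)).+1.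
Proof. by rewrite !blanks_cat /blanks /=; lia. Qed.

(** The case split of both strategies: a run worth moving in, or a constraint on every run. *)
Lemma gap_case (P : nat -> nat -> bool) (a : bool) s :
  (exists s1 k p s2,
     s = s1 ++ (k, p) :: s2 /\ P (last a (unzip2 s1) + p) k) \/
  (forall s1 k p s2,
     s = s1 ++ (k, p) :: s2 -> ~~ P (last a (unzip2 s1) + p) k).
Proof.
elim: s a => [|[k p] s IHs] a; first by right=> -[|? ?].
have [Pk|nPk] := boolP (P (a + p) k).
  by left; exists [::], k, p, s.
have [[s1 [k1 [p1 [s2 [-> Pk1]]]]]|nP] := IHs p.
  by left; exists ((k, p) :: s1), k1, p1, s2.
by right=> -[|g s1] k1 p1 s2 [] => [<- <- _|<- /nP].
Qed.

Lemma dvdn_pot W d (a : bool) s :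
  (forall s1 k p s2,
     s = s1 ++ (k, p) :: s2 -> d %| W (last a (unzip2 s1) + p) k) ->
  d %| pot W a s.
Proof.
elim: s a => //= -[k p] s IHs a dW; apply: dvdn_add; first exact: (dW [::] k p s).
apply: IHs => s1 k1 p1 s2 es; apply: (dW ((k, p) :: s1) k1 p1 s2).
by rewrite es.
Qed.

Lemma blanks_gt0 s : 0 < blanks s ->
  exists s1 k p s2, s = s1 ++ (k, p) :: s2 /\ 0 < k.
Proof.
move=> s0; have [//|h] := gap_case (fun _ k => 0 < k) false s.
suff : blanks s = 0 by move=> s00; rewrite s00 in s0.
elim: s h {s0} => //= -[k p] s IHs h.
have := h [::] k p s erefl; rewrite -eqn0Ngt /blanks /= => /eqP -> /=.
rewrite add0n; apply: IHs => s1 k1 p1 s2 es.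
by have := h ((k, p) :: s1) k1 p1 s2; rewrite es; apply.
Qed.

(** * Vertices and edges of the cycle, indexed from a base vertex *)

Definition vertex_at n (c : 'I_n) (j : nat) : 'I_n := iter j (@ordS n) c.

Definition edge_at n (c : 'I_n) (j : nat) : {set 'I_n} :=
  [set vertex_at c j; vertex_at c j.+1].

Lemma val_vertex_at n (c : 'I_n) j : vertex_at c j = (c + j) %% n :> nat.
Proof.
elim: j => [|j IHj]; first by rewrite addn0 modn_small.
rewrite [vertex_at c _]/(ordS (vertex_at c j)) /=.
by rewrite IHj addnS -addn1 modnDml addn1.
Qed.

Lemma eq_vertex_at n (c : 'I_n) i j :
  (vertex_at c i == vertex_at c j) = (i == j %[mod n]).
Proof.
by rewrite -(inj_eq (@ord_inj n)) (val_vertex_at c i) (val_vertex_at c j)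
  eqn_modDl.
Qed.

Lemma vertex_at_size n (c : 'I_n) : vertex_at c n = c.
Proof. by apply: val_inj; rewrite /= (val_vertex_at c _) modnDr modn_small. Qed.

Lemma vertex_at_surj n (c v : 'I_n) : exists j : 'I_n, v = vertex_at c j.
Proof.
have n0 : 0 < n by apply: leq_ltn_trans (ltn_ord c).
exists (Ordinal (ltn_pmod (n - c + v) n0)).
apply: val_inj; rewrite /= (val_vertex_at c _) /= modnDmr.
have -> : c + (n - c + v) = n + v by have := ltn_ord c; lia.
by rewrite modnDl modn_small.
Qed.

Lemma mem_edge_at n (c : 'I_n) (i j : nat) : i < n -> j < n ->
  (vertex_at c i \in edge_at c j) =
  (i == j) || (i == j.+1) || (i == 0) && (j.+1 == n).
Proof.
move=> ilt jlt; rewrite in_set2 !eq_vertex_at !(modn_small ilt) (modn_small jlt).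
rewrite -orbA; congr (_ || _).
have [->|jn] := eqVneq j.+1 n; first by rewrite modnn andbT; lia.
by rewrite modn_small ?andbF ?orbF //; lia.
Qed.

(** If equal edges had different indices, each index would be the cyclic successor of the other,
    which forces [n = 2]. *)
Lemma edge_at_inj n (c : 'I_n) i j : 2 < n -> i < n -> j < n ->
  edge_at c i = edge_at c j -> i = j.
Proof.
move=> n2 ilt jlt eij.
have := mem_edge_at c ilt ilt; have := mem_edge_at c ilt jlt.
have := mem_edge_at c jlt ilt; have := mem_edge_at c jlt jlt; rewrite eij; lia.
Qed.

Lemma edges_cycle n (c : 'I_n) : 2 < n ->
  edges (cycle_graph n) = [set edge_at c j | j : 'I_n].
Proof.
move=> n2; apply/setP => e; apply/imsetP/imsetP => [[[x y] /=]|[j _ ->]].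
  rewrite inE /= /cycle_adj => /andP[_ xy] ->.
  case/orP: xy => /eqP ->; 
    [have [j ->] := vertex_at_surj c x|have [j ->] := vertex_at_surj c y].
    by exists j.
  by exists j; rewrite // setUC.
exists (vertex_at c j, vertex_at c j.+1) => //.
suff ne : vertex_at c j != vertex_at c j.+1.
  by rewrite inE; apply/andP; split; rewrite ?eqxx.
rewrite eq_vertex_at.
have := ltn_ord j => jn; rewrite (modn_small jn).
have [jn'|jn'] := eqVneq j.+1 n; first by rewrite jn' modnn; lia.
rewrite modn_small; lia.
Qed.

(** * Game positions and moves in terms of gap sequences *)

Definition claimed n (c : 'I_n) (q : bool) (w : seq (option bool)) :
    {set {set 'I_n}} :=
  [set edge_at c j | j : 'I_n & nth None w j == Some q].

Lemma mem_claimed n (c : 'I_n) q w (j : 'I_n) : 2 < n ->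
  (edge_at c j \in claimed c q w) = (nth None w j == Some q).
Proof.
move=> n2; apply/imsetP/idP => [[i]|wj]; last by exists j; rewrite ?inE.
by rewrite inE => wi /(edge_at_inj n2 (ltn_ord j) (ltn_ord i)) ->.
Qed.

Lemma unclaimed_claimed n (c : 'I_n) w : 2 < n ->
  @unclaimed (cycle_graph n) (claimed c false w) (claimed c true w) =
  [set edge_at c j | j : 'I_n & nth None w j == None].
Proof.
move=> n2; apply/setP => e; rewrite !inE (edges_cycle c n2).
apply/andP/imsetP => [[h /imsetP[j _ je]]|[j wj ->]].
  exists j => //; move: h; rewrite je !mem_claimed // inE.
  by case: (nth _ _ _) => [[]|].
split; last exact: imset_f.
by rewrite !mem_claimed //; move: wj; rewrite inE => /eqP ->.
Qed.

Lemma claimed_set_nth n (c : 'I_n) q p w (j : 'I_n) : nth None w j = None ->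
  claimed c q (set_nth None w j (Some p)) =
  if p == q then edge_at c j |: claimed c q w else claimed c q w.
Proof.
move=> wj; rewrite /claimed.
have -> : [set i : 'I_n | nth None (set_nth None w j (Some p)) i == Some q] =
    if p == q then j |: [set i : 'I_n | nth None w i == Some q]
    else [set i : 'I_n | nth None w i == Some q].
  apply/setP => i; rewrite inE nth_set_nth /= val_eqE.
  case: (eqVneq i j) => [->|ij]; case: (eqVneq p q) => pq;
    rewrite ?pq !inE ?eqxx ?wj //.
  - by apply: contraNF pq => /eqP[->].
  - by rewrite (negPf ij).
by case: eqP => // _; rewrite imsetU1.
Qed.

Lemma bigminn_le (I : finType) (P : pred I) (F : I -> nat) x0 i :
  P i -> \big[minn/x0]_(j | P j) F j <= F i.
Proof.
move=> Pi; elim: (index_enum I) (mem_index_enum i) => // j r IHr.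
rewrite inE big_cons => /orP[/eqP <-|/IHr]; first by rewrite Pi geq_minl.
by case: ifP => // _; apply: leq_trans; apply: geq_minr.
Qed.

Definition cval n (c : 'I_n) k p (s : seq (nat * bool)) : nat :=
  @game_value (cycle_graph n) k p
    (claimed c false (gap_word s)) (claimed c true (gap_word s)).

Lemma edge_at_unclaimed n (c : 'I_n) (n2 : 2 < n)
    s1 i k p s2 (s := s1 ++ (i + k.+1, p) :: s2) :
  size (gap_word s) = n ->
  exists j : 'I_n, [/\ j = size (gap_word s1) + i :> nat,
    nth None (gap_word s) j = None &
    edge_at c j \in @unclaimed (cycle_graph n) (claimed c false (gap_word s))
                                         (claimed c true (gap_word s))].
Proof.
move=> sn; have jn : size (gap_word s1) + i < n.
  by rewrite -sn gap_word_cat size_cat gap_word_cons size_cat size_nseq /=; lia.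
exists (Ordinal jn); split=> //; first exact: nth_gap_word.
rewrite unclaimed_claimed //; apply: imset_f; rewrite inE; apply/eqP.
exact: nth_gap_word.
Qed.

Lemma unclaimed_edge_at n (c : 'I_n) (n2 : 2 < n) s e : size (gap_word s) = n ->
  e \in @unclaimed (cycle_graph n) (claimed c false (gap_word s))
                                   (claimed c true (gap_word s)) ->
  exists s1 i k p s2, exists j : 'I_n,
    [/\ s = s1 ++ (i + k.+1, p) :: s2, j = size (gap_word s1) + i :> nat,
        nth None (gap_word s) j = None & e = edge_at c j].
Proof.
move=> sn; rewrite unclaimed_claimed // => /imsetP[j].
rewrite inE => /eqP wj ->; have := ltn_ord j; rewrite -[X in _ < X]sn => jlt.
have [s1 [i [k [p [s2 [es ej]]]]]] := gap_word_split jlt wj.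
by exists s1, i, k, p, s2, j.
Qed.

Lemma cval_toucher_le n (c : 'I_n) (n2 : 2 < n)
    k s1 i j p s2 (s := s1 ++ (i + j.+1, p) :: s2) :
  size (gap_word s) = n ->
  cval c k.+1 Toucher s <= cval c k Isolator (s1 ++ (i, false) :: (j, p) :: s2).
Proof.
move=> sn; have [x [xE wx ux]] := edge_at_unclaimed c n2 sn.
rewrite /cval -(set_nth_gap_word s1 i j p s2 false) -xE !claimed_set_nth //=.
exact: (@bigminn_le _ _ (fun e => game_value _ _ _ _) _ _ ux).
Qed.

Lemma cval_isolator_ge n (c : 'I_n) (n2 : 2 < n)
    k s1 i j p s2 (s := s1 ++ (i + j.+1, p) :: s2) :
  size (gap_word s) = n ->
  cval c k Toucher (s1 ++ (i, true) :: (j, p) :: s2) <= cval c k.+1 Isolator s.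
Proof.
move=> sn; have [x [xE wx ux]] := edge_at_unclaimed c n2 sn.
rewrite /cval -(set_nth_gap_word s1 i j p s2 true) -xE !claimed_set_nth //=.
exact: (@leq_bigmax_cond _ _ (fun e => game_value _ _ _ _) _ ux).
Qed.

(** The minimum is either the value of some move or the default [n], hence the premise [Q n]. *)
Lemma cval_toucher_ind n (c : 'I_n) (n2 : 2 < n) (Q : nat -> Prop) k s :
  size (gap_word s) = n ->
  Q n ->
  (forall s1 i j p s2, s = s1 ++ (i + j.+1, p) :: s2 ->
     Q (cval c k Isolator (s1 ++ (i, false) :: (j, p) :: s2))) ->
  Q (cval c k.+1 Toucher s).
Proof.
move=> sn Qn Qs; rewrite /cval /=.
apply: big_ind => [|x y Qx Qy|e]; first by rewrite card_ord.
  by rewrite /minn; case: ifP.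
move=> /(unclaimed_edge_at n2 sn)[s1 [i [j [p [s2 [x [es xE wx ->]]]]]]].
have := Qs _ _ _ _ _ es.
by rewrite /cval -set_nth_gap_word -es -xE !claimed_set_nth.
Qed.

Lemma cval_isolator_ind n (c : 'I_n) (n2 : 2 < n) (Q : nat -> Prop) k s :
  size (gap_word s) = n ->
  Q 0 ->
  (forall s1 i j p s2, s = s1 ++ (i + j.+1, p) :: s2 ->
     Q (cval c k Toucher (s1 ++ (i, true) :: (j, p) :: s2))) ->
  Q (cval c k.+1 Isolator s).
Proof.
move=> sn Q0 Qs; rewrite /cval /=.
apply: big_ind => [//|x y Qx Qy|e].
  by rewrite /maxn; case: ifP.
move=> /(unclaimed_edge_at n2 sn)[s1 [i [j [p [s2 [x [es xE wx ->]]]]]]].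
have := Qs _ _ _ _ _ es.
by rewrite /cval -set_nth_gap_word -es -xE !claimed_set_nth.
Qed.

(** * Final positions *)

Lemma blanks0 s : blanks s = 0 -> s = [seq (0, b) | b <- unzip2 s].
Proof.
rewrite /blanks; elim: s => //= -[k b] s IHs /eqP.
by rewrite addn_eq0 /= => /andP[/eqP -> /eqP /IHs <-].
Qed.

Lemma pot_full W (a : bool) bs : W 0 0 = 0 -> W 1 0 = 0 ->
  pot W a [seq (0, b) | b <- bs] =
  W 2 0 * \sum_(j < size bs) (nth false (a :: bs) j && nth false bs j).
Proof.
move=> W0 W1; elim: bs a => [|b bs IHbs] a /=; first by rewrite big_ord0 muln0.
rewrite big_ord_recl /= mulnDr IHbs; congr (_ + _).
by case: a; case: b; rewrite /= ?W0 ?W1 ?muln1 ?muln0.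
Qed.

Lemma touched_full n (c : 'I_n) bs (j : 'I_n) : size bs = n ->
  last false bs = false ->
  @touched (cycle_graph n) (claimed c false [seq Some b | b <- bs]) (vertex_at c j) =
  ~~ (nth false (false :: bs) j && nth false bs j).
Proof.
move=> sbs lbs; have wE (i : 'I_n) :
    (nth None [seq Some b | b <- bs] i == Some false) = ~~ nth false bs i.
  by rewrite (nth_map false) ?sbs //; case: nth.
rewrite negb_and; apply/exists_inP/orP => [[e /imsetP[i]]|].
  rewrite inE wE => bi -> /=.
  rewrite (@mem_edge_at n c) // => /orP[/orP[]|/andP[]] /eqP ji.
  - by right; rewrite ji.
  - by left; rewrite ji.
  - by left; rewrite ji.
(* The edge before vertex 0 is the last one, which is Toucher's by hypothesis. *)
case: (posnP j) => [j0 _|j0].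
  have n1 : n.-1 < n by have := ltn_ord j; lia.
  exists (edge_at c (Ordinal n1)).
    by apply/imsetP; exists (Ordinal n1); rewrite // inE wE /= -sbs nth_last lbs.
  by rewrite (@mem_edge_at n c) //= j0 /= prednK ?eqxx ?orbT //; lia.
case=> bj; last first.
  exists (edge_at c j); last by rewrite (@mem_edge_at n c) // eqxx.
  by apply/imsetP; exists j; rewrite // inE wE.
have j1 : j.-1 < n by have := ltn_ord j; lia.
exists (edge_at c (Ordinal j1)); last first.
  by rewrite (@mem_edge_at n c) //= prednK // eqxx orbT.
apply/imsetP; exists (Ordinal j1) => //; rewrite inE wE /=.
by move: bj; rewrite -{1}(prednK j0).
Qed.

(** With all gaps empty, only gaps between two Isolator edges count, and these are the untouched
    vertices. As the last edge is Toucher's, the [false] that starts [pot] is the true owner of the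
    edge before the first gap. *)
Lemma pot_end W n (c : 'I_n) p s : W 0 0 = 0 -> W 1 0 = 0 ->
  size (gap_word s) = n -> last false (unzip2 s) = false -> blanks s = 0 ->
  pot W false s = W 2 0 * cval c 0 p s.
Proof.
move=> W0 W1 sn ls s0; rewrite /cval /=.
have sE := blanks0 s0; move: sn ls; rewrite sE.
set bs := unzip2 s.
have -> : gap_word [seq (0, b) | b <- bs] = [seq Some b | b <- bs].
  by elim: bs {sE} => //= b bs IHbs; rewrite gap_word_cons IHbs.
rewrite size_map => sbs; have -> : unzip2 [seq (0, b) | b <- bs] = bs.
  by rewrite /unzip2 -map_comp map_id.
move=> lbs; rewrite (pot_full _ _ W0 W1) sbs; congr (_ * _).
have step_bij : bijective (fun j : 'I_n => vertex_at c j).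
  apply: injF_bij => i j /eqP; rewrite eq_vertex_at !modn_small // => /eqP.
  exact: val_inj.
rewrite -[RHS]sum1_card [RHS]big_mkcond.
rewrite [RHS](reindex (fun j : 'I_n => vertex_at c j)) /=; last exact: onW_bij.
apply: eq_bigr => j _; rewrite inE (@touched_full n c) // negbK.
by case: (_ && _).
Qed.

(** * The two bounds, by induction on the number of unclaimed edges *)

Definition gaps_of n (s : seq (nat * bool)) :=
  size (gap_word s) = n /\ last false (unzip2 s) = false.

Lemma gaps_of_split n s1 i j p s2 q :
  gaps_of n (s1 ++ (i + j.+1, p) :: s2) ->
  gaps_of n (s1 ++ (i, q) :: (j, p) :: s2).
Proof.
case=> sn ls; split; last by move: ls; rewrite /unzip2 !map_cat !last_cat.
by rewrite -sn -(set_nth_gap_word _ _ _ _ _ q) size_set_nth; apply/maxn_idPr;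
  rewrite gap_word_cat size_cat gap_word_cons size_cat size_nseq /=; lia.
Qed.

Lemma pot_split W s1 k p s2 :
  pot W false (s1 ++ (k, p) :: s2) =
  pot W false s1 + W (last false (unzip2 s1) + p) k + pot W p s2.
Proof. by rewrite pot_cat /= addnA. Qed.

(** The third clause lets Toucher lower any prescribed run from [hi] to [lo], which is how he
    answers Isolator's cut. Where [hi] and [lo] agree, it reduces to the second clause. *)
Lemma upper_bound n (c : 'I_n) k s : 2 < n -> gaps_of n s -> blanks s = k ->
  [/\ 2 * cval c k Isolator s <= pot hi false s + 1,
      2 * cval c k Toucher s <= pot hi false s &
      forall s1 g p s2, s = s1 ++ (g, p) :: s2 ->
        2 * cval c k Toucher s + hi (last false (unzip2 s1) + p) g <=
        pot hi false s + lo (last false (unzip2 s1) + p) g].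
Proof.
move=> n2; elim: k s => [|k IHk] s ns sk.
  have [sn ls] := ns.
  have e p : pot hi false s = 2 * cval c 0 p s by apply: pot_end.
  split; [by rewrite -e; lia | by rewrite -e | move=> s1 g p s2 es].
  rewrite -e.
  have -> : g = 0 by move: sk; rewrite es blanks_cat /blanks /=; lia.
  by rewrite leq_add2l; case: (last _ _); case: p {es}.
have good s1 g (p : bool) s2 (d := last false (unzip2 s1) + p) :
    s = s1 ++ (g, p) :: s2 -> (0 < g) && ((0 < d) || (2 < g)) ->
    2 * cval c k.+1 Toucher s + hi d g <= pot hi false s + lo d g.
  move=> es /andP[g0 gd].
  have [i [j [eg hij]]] := hi_toucher g0 gd; subst g s.
  have := cval_toucher_le c n2 k ns.1.
  move: sk; rewrite (blanks_split _ _ _ _ _ false) => -[sk].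
  have [+ _ _] := IHk _ (gaps_of_split false ns) sk.
  by rewrite !pot_split /= -/d ?addn0 ?add0n; move: hij; rewrite -/d; lia.
have even_bound : 2 * cval c k.+1 Toucher s <= pot hi false s.
  have [[s1 [g [p [s2 [es gd]]]]]|bad] :=
    gap_case (fun d g => (0 < g) && ((0 < d) || (2 < g))) false s.
    have := lo_le_hi (last false (unzip2 s1)) p g.
    by have := good _ _ _ _ es gd; lia.
  (* No run offers a gain, so all weights are 0 or 2. Toucher takes the first edge of a weightless
     run: the total is unchanged, and the [+ 1] is absorbed by parity. *)
  have /dvdnP[q qE] : 2 %| pot hi false s.
    apply: dvdn_pot => s1 g p s2 /bad.
    by case: (last _ _); case: p; case: g => [|[|[|g]]].
  have [|s1 [g [p [s2 [es g0]]]]] := @blanks_gt0 s; first by rewrite sk.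
  have := bad _ _ _ _ es; rewrite g0 /= negb_or -leqNgt -leqNgt.
  rewrite leqn0 addn_eq0 !eqb0.
  move=> /andP[/andP[/negPf l0 /negPf p0] g2]; subst p s.
  case: g g0 g2 ns sk qE {good bad} => // g _ g2 ns sk qE.
  have := @cval_toucher_le n c n2 k s1 0 g false s2 ns.1.
  move: sk; rewrite (@blanks_split s1 0 g false s2 false) => -[sk].
  have [+ _ _] := IHk _ (@gaps_of_split n s1 0 g false s2 false ns) sk.
  rewrite add0n qE; move: qE; rewrite !pot_split /= l0 /=.
  by case: g g2 {ns sk} => [|[|g]] //= _; rewrite /hi /=; lia.
split=> // [|s1 g p s2 es].
  apply: (@cval_isolator_ind n c n2 (fun v => 2 * v <= pot hi false s + 1)) => //.
    exact: ns.1.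
  move=> s1 i j p s2 es; subst s.
  move: sk; rewrite (blanks_split _ _ _ _ _ true) => -[sk].
  have [_ _ third] := IHk _ (gaps_of_split true ns) sk.
  have := third _ _ _ _ erefl; have := third (rcons s1 (i, true)) j p s2.
  rewrite cat_rcons => /(_ erefl); rewrite {}/third.
  rewrite /unzip2 map_rcons last_rcons !pot_split /=.
  have := hi_isolator (last false (unzip2 s1)) p i j.
  rewrite /unzip2; lia.
set d := last false (unzip2 s1) + p.
have [gd|] := boolP ((0 < g) && ((0 < d) || (2 < g))); first exact: good es gd.
move: even_bound; suff : ~~ ((0 < g) && ((0 < d) || (2 < g))) -> hi d g = lo d g.
  by move=> h + /h ->; rewrite leq_add2r.
by rewrite /d; case: (last _ _); case: p {d es}; case: g => [|[|[|g]]].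
Qed.

Lemma pot_pw_le (a : bool) s : pot pw a s <= 4 * (blanks s + size s).
Proof.
elim: s a => //= -[k p] s IHs a; have := IHs p; have := pw_le_size a p k.
by rewrite /blanks /=; lia.
Qed.

(** The third clause is Isolator's answer in a prescribed run, at the price of 1; the second removes
    that price when she may choose the run. *)
Lemma lower_bound n (c : 'I_n) k s : 2 < n -> gaps_of n s -> blanks s = k ->
  [/\ pot pw false s <= 4 * cval c k Toucher s + 3,
      pot pw false s <= 4 * cval c k Isolator s &
      forall s1 g p s2, s = s1 ++ (g, p) :: s2 ->
        pot pw false s + 2 * hi (last false (unzip2 s1) + p) g <=
        4 * cval c k Isolator s + pw (last false (unzip2 s1) + p) g + 1].
Proof.
move=> n2; elim: k s => [|k IHk] s ns sk.
  have [sn ls] := ns.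
  have e p : pot pw false s = 4 * cval c 0 p s by apply: pot_end.
  split; [by rewrite -e; lia | by rewrite -e | move=> s1 g p s2 es].
  rewrite -e.
  have -> : g = 0 by move: sk; rewrite es blanks_cat /blanks /=; lia.
  by rewrite -addnA leq_add2l; case: (last _ _); case: p {es}.
have good s1 g (p : bool) s2 (d := last false (unzip2 s1) + p) :
    s = s1 ++ (g, p) :: s2 -> (0 < g) && ((0 < d) || (1 < g)) ->
    pot pw false s + 2 * hi d g <= 4 * cval c k.+1 Isolator s + pw d g + 1.
  move=> es /andP[g0 gd].
  have [i [j [eg hij]]] := pw_isolator g0 gd; subst g s.
  have := cval_isolator_ge c n2 k ns.1.
  move: sk; rewrite (blanks_split _ _ _ _ _ true) => -[sk].
  have [+ _ _] := IHk _ (gaps_of_split true ns) sk.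
  by rewrite !pot_split /= -/d; move: hij; rewrite -/d; lia.
have bound : pot pw false s <= 4 * cval c k.+1 Isolator s.
  (* Isolator prefers a run of odd weight. If there is none, the total is even, and a loss of 1 is
     absorbed modulo 4. *)
  have [[s1 [g [p [s2 [es odd_g]]]]]|even] :=
    gap_case (fun d g => odd (pw d g)) false s.
    have := odd_pw_lt_hi odd_g; suff /(good _ _ _ _ es) : (0 < g) &&
      ((0 < last false (unzip2 s1) + p) || (1 < g)) by lia.
    by move: odd_g; case: (last _ _); case: p {es}; case: g => [|[|g]].
  have /dvdnP[q qE] : 2 %| pot pw false s.
    by apply: dvdn_pot => s1 g p s2 /even; rewrite dvdn2.
  have [[s1 [g [p [s2 [es gd]]]]]|bad] :=
    gap_case (fun d g => (0 < g) && ((0 < d) || (1 < g))) false s.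
    have := pw_le_hi (last false (unzip2 s1)) p g.
    by have := good _ _ _ _ es gd; lia.
  (* Only empty gaps and single edges between Toucher's edges remain, of weight 0 or 4. Claiming
     such an edge keeps the total, and divisibility by 4 absorbs the slack 3. *)
  have /dvdnP[r rE] : 4 %| pot pw false s.
    apply: dvdn_pot => s1 g p s2 /bad.
    by case: (last _ _); case: p; case: g => [|[|g]].
  have [|s1 [g [p [s2 [es g0]]]]] := @blanks_gt0 s; first by rewrite sk.
  have := bad _ _ _ _ es; rewrite g0 /= negb_or -leqNgt -leqNgt.
  rewrite leqn0 addn_eq0 !eqb0.
  move=> /andP[/andP[/negPf l0 /negPf p0] g1]; subst p s.
  have g1E : g = 1 by lia.
  subst g.
  have := @cval_isolator_ge n c n2 k s1 0 0 false s2 ns.1.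
  move: sk; rewrite (@blanks_split s1 0 0 false s2 true) => -[sk].
  have [+ _ _] := IHk _ (@gaps_of_split n s1 0 0 false s2 true ns) sk.
  rewrite add0n rE; move: rE; rewrite !pot_split /= l0 /= {1}/pw /lo /=.
  by rewrite !(muln0, addn0); lia.
split=> // [|s1 g p s2 es].
  apply: (@cval_toucher_ind n c n2 (fun v => pot pw false s <= 4 * v + 3)) => //.
  - exact: ns.1.
  (* The default [n] of the minimum is harmless, since the total is at most [4 * n]. *)
  - by have := pot_pw_le false s; rewrite -size_gap_word ns.1; lia.
  move=> s1 i j p s2 es; subst s.
  move: sk; rewrite (blanks_split _ _ _ _ _ false) => -[sk].
  have [_ second third] := IHk _ (gaps_of_split false ns) sk.
  have := third _ _ _ _ erefl; have := third (rcons s1 (i, false)) j p s2.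
  rewrite cat_rcons => /(_ erefl); move: second; rewrite {}/third.
  rewrite /unzip2 map_rcons last_rcons !pot_split /=.
  have := pw_toucher (last false (unzip2 s1)) p i j.
  by rewrite /unzip2 !addn0 !add0n => -[]; lia.
set d := last false (unzip2 s1) + p.
have [gd|] := boolP ((0 < g) && ((0 < d) || (1 < g))); first exact: good es gd.
move: bound; suff : ~~ ((0 < g) && ((0 < d) || (1 < g))) -> 2 * hi d g <= pw d g + 1.
  by move=> h + /h; lia.
by rewrite /d; case: (last _ _); case: p {d es}; case: g => [|[|g]].
Qed.

(** * The first move and the value of the game *)

Lemma cval_first n (c : 'I_n) : 2 < n ->
  cval c n.-1 Isolator [:: (n.-1, false)] = (n + 1) %/ 5.
Proof.
move=> n2; set s := [:: _].
have ns : gaps_of n s by rewrite /gaps_of size_gap_word /blanks /=; split=> //; lia.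
have sk : blanks s = n.-1 by rewrite /blanks /= addn0.
have [hiI _ _] := upper_bound c n2 ns sk.
have [_ loI _] := lower_bound c n2 ns sk.
by move: hiI loI; rewrite /= /pw /hi /lo /=; lia.
Qed.

(** The base vertex is free, so Toucher's first edge can always be made the last one, leaving a
    single gap. *)
Lemma edge_at_last n (e : {set cycle_graph n}) : e \in edges (cycle_graph n) ->
  exists c : 'I_n, e = edge_at c n.-1.
Proof.
have last_edge (x : 'I_n) : edge_at (ordS x) n.-1 = [set x; ordS x].
  have n0 : 0 < n by apply: leq_ltn_trans (ltn_ord x).
  rewrite /edge_at (prednK n0) vertex_at_size /vertex_at -iterSr (prednK n0).
  by rewrite -[iter _ _ _]/(vertex_at x n) vertex_at_size.
move=> /imsetP[[x y]]; rewrite inE /= => /andP[_ /orP[]] /eqP -> ->.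
  by exists (ordS x); rewrite last_edge.
by exists (ordS y); rewrite last_edge setUC.
Qed.

Lemma claimed_first n (c : 'I_n) : 0 < n ->
  (claimed c false (gap_word [:: (n.-1, false)]) = [set edge_at c n.-1]) *
  (claimed c true (gap_word [:: (n.-1, false)]) = set0).
Proof.
move=> n0; have nlt : n.-1 < n by rewrite prednK.
have wE q (j : 'I_n) : (nth None (gap_word [:: (n.-1, false)]) j == Some q) =
    (j == n.-1 :> nat) && ~~ q.
  rewrite gap_word_cons /= nth_cat size_nseq nth_nseq.
  have jlt := ltn_ord j; case: ltngtP => [//|jn|->]; first by exfalso; lia.
  by rewrite subnn; case: q.
split; apply/setP => e; rewrite inE; last first.
  by apply/imsetP => -[j]; rewrite inE wE andbF.
apply/imsetP/eqP => [[j]|->]; first by rewrite inE wE => /andP[/eqP <-].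
by exists (Ordinal nlt); rewrite // inE wE eqxx.
Qed.

Theorem theorem1 (n : nat) (hn : 3 <= n) : u (cycle_graph n) = (n + 1) %/ 5.
Proof.
have n0 : 0 < n by lia.
pose c0 : 'I_n := Ordinal n0.
have -> : u (cycle_graph n) =
    @game_value (cycle_graph n) n.-1.+1 Toucher set0 set0.
  rewrite /u (edges_cycle c0 hn) card_imset ?card_ord ?(prednK n0) //.
  by move=> i j /(edge_at_inj hn (ltn_ord i) (ltn_ord j)) /val_inj.
(* All first moves have the same value, so the outer minimum is that value. *)
have value e : e \in @unclaimed (cycle_graph n) set0 set0 ->
    @game_value (cycle_graph n) n.-1 Isolator (e |: set0) set0 = (n + 1) %/ 5.
  rewrite !inE => /andP[_ /edge_at_last[c ->]]; rewrite -(cval_first c hn) /cval.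
  by rewrite !claimed_first // setU0.
have e0 : edge_at c0 0 \in @unclaimed (cycle_graph n) set0 set0.
  by rewrite !inE (edges_cycle c0 hn); apply: (imset_f _ (x := c0)).
apply/eqP; rewrite eqn_leq; apply/andP; split.
  rewrite -(value _ e0).
  exact: (@bigminn_le _ _ (fun e => game_value _ _ _ _) _ _ e0).
apply: (big_ind (fun v => (n + 1) %/ 5 <= v)) => [|x y|e eU].
  by rewrite card_ord; lia.
by rewrite leq_min => -> ->.
by rewrite -(value e eU).
Qed.
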